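(* Let $n \in \mathbb{N}$. The ZX-calculus with affine maps $\mathbb{R}^n \to \mathbb{R}$ as phases admits diagrammatic differentiation: for each partial derivative $\partial = \partial_i$ with respect to one of the $n$ real variables, there is a derivation $\partial$ on the category of formal sums of ZX diagrams with affine phases such that $[\![\partial d]\!] = \partial [\![d]\!]$ for all formal sums of diagrams $d$.
   Context: The ZX-calculus here is the free symmetric strict monoidal category generated by one object $x$, a box $H : x \to x$ and boxes (green spiders) $Z^{k,l}(\alpha) : x^{\otimes k} \to x^{\otimes l}$ for $k,l \in \mathbb{N}$ and phases $\alpha : \mathbb{R}^n \to \mathbb{R}$; in this statement the phases range over the affine maps. The arrows of this free category are diagrams with these boxes and swaps, modulo only the axioms of symmetric monoidal categories. Let $S$ be the commutative rig of smooth functions $\mathbb{R}^n \to \mathbb{C}$ with pointwise operations, with derivation the partial derivative $\partial = \partial_i$. $\mathbf{Mat}_S$ has natural numbers as objects and matrices over $S$ as arrows, with the Kronecker product as tensor; it has entrywise sums, and $\partial$ acts on it entrywise. The interpretation $[\![-]\!]$ is the symmetric monoidal functor into $\mathbf{Mat}_S$ with $[\![x]\!] = 2$, $$[\![H]\!] = \tfrac{1}{\sqrt{2}}\big(|0\rangle\langle 0| + |0\rangle\langle 1| + |1\rangle\langle 0| - |1\rangle\langle 1|\big),\qquad [\![Z^{k,l}(\alpha)]\!] = e^{-i\alpha/2} |0\rangle^{\otimes l}\langle 0|^{\otimes k} + e^{i\alpha/2}|1\rangle^{\otimes l}\langle 1|^{\otimes k}.$$ Formal sums: the category of formal sums has the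 same objects, and its arrows are finite formal sums (multisets, including the empty sum $0$) of parallel diagrams; composition and tensor distribute over sums. The interpretation extends to it, preserving sums. A derivation on a monoidal category with sums is a unary operator $\partial$ on homsets, $C(x,y) \to C(x,y)$, which preserves sums and satisfies $\partial(f ; g) = (\partial f) ; g + f ; (\partial g)$ and $\partial(f \otimes g) = (\partial f) \otimes g + f \otimes (\partial g)$; equivalently $f \mapsto f + (\partial f)\epsilon$ is a sum-preserving monoidal functor into the category of dual arrows $f + f'\epsilon$ with $\epsilon\otimes\epsilon = 0$ (in particular identities have derivative $0$). *)

(* Defs.v *)
From HB Require Import structures.
From mathcomp Require Import all_boot all_order all_algebra.
From mathcomp Require Import generic_quotient finmap multiset.
From mathcomp Require Import complex mxtens.
From mathcomp Require Import all_classical reals topology normedtype derive.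
From mathcomp Require Import sequences realfun exp trigo.

Set Implicit Arguments.
Unset Strict Implicit.
Unset Printing Implicit Defensive.

Import Order.TTheory GRing.Theory Num.Theory.
Import numFieldNormedType.Exports.

Local Open Scope classical_set_scope.
Local Open Scope ring_scope.

Section SmoothFunctions.
Variables (R : realType) (n : nat).
Local Notation V := ('rV[R]_n).
Implicit Types (f g : V -> R) (F G : V -> R[i]) (i : 'I_n).

Definition pderiv i f : V -> R := 'D_(delta_mx 0 i) f.

Definition pderivable i f : Prop :=
  forall x : V, derivable f x (delta_mx 0 i).

(* f has continuous iterated partial derivatives up to order k *)
Fixpoint Ck (k : nat) f : Prop :=
  match k with
  | 0 => continuous f
  | k'.+1 => [/\ continuous f, forall i, pderivable i f
               & forall i, Ck k' (pderiv i f)]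
  end.

Definition smooth f : Prop := forall k, Ck k f.

Definition reC F : V -> R := fun x => complex.Re (F x).
Definition imC F : V -> R := fun x => complex.Im (F x).

(* Smoothness of a complex-valued function of real variables is taken
   componentwise, since R[i] is a normed module over itself, not over R. *)
Definition smoothC : {pred V -> R[i]} :=
  fun F => `[< smooth (reC F) /\ smooth (imC F) >].

Lemma CkW k f : Ck k.+1 f -> Ck k f.
Proof.
elim: k f => [|k IH] f; first by case.
by case=> cf df Cf; split=> // i; apply: IH; apply: Cf.
Qed.

Lemma Ck_cst k c : Ck k (cst c).
Proof.
elim: k c => [|k IH] c /=; first exact: cst_continuous.
split; first exact: cst_continuous.
  by move=> i x; exact: derivable_cst.
move=> i; rewrite (_ : pderiv i (cst c) = cst 0) //.
by apply/funext => x; rewrite /pderiv derive_cst.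
Qed.

Lemma Ck_add k f g : Ck k f -> Ck k g -> Ck k (f + g).
Proof.
elim: k f g => [|k IH] f g /=.
  by move=> cf cg x; exact: continuousD (cf x) (cg x).
move=> [cf df Cf] [cg dg Cg]; split.
- by move=> x; exact: continuousD (cf x) (cg x).
- by move=> i x; apply: derivableD; [exact: df|exact: dg].
move=> i; rewrite (_ : pderiv i (f + g) = pderiv i f + pderiv i g).
  by apply: IH.
by apply/funext => x; rewrite /pderiv deriveD //; [exact: df|exact: dg].
Qed.

Lemma Ck_mul k f g : Ck k f -> Ck k g -> Ck k (f * g).
Proof.
elim: k f g => [|k IH] f g.
  by move=> cf cg x; exact: continuousM (cf x) (cg x).
move=> Hf Hg; have [cf df Cf] := Hf; have [cg dg Cg] := Hg; split.
- by move=> x; exact: continuousM (cf x) (cg x).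
- by move=> i x; apply: derivableM; [exact: df|exact: dg].
move=> i; rewrite (_ : pderiv i (f * g) = f * pderiv i g + g * pderiv i f).
  apply: Ck_add; apply: IH;
    [exact: CkW|exact: Cg i|exact: CkW|exact: Cf i].
by apply/funext => x; rewrite /pderiv deriveM //; [exact: df|exact: dg].
Qed.

Lemma smooth_cst c : smooth (cst c). Proof. by move=> k; exact: Ck_cst. Qed.

Lemma smoothD f g : smooth f -> smooth g -> smooth (f + g).
Proof. by move=> sf sg k; apply: Ck_add. Qed.

Lemma smoothM f g : smooth f -> smooth g -> smooth (f * g).
Proof. by move=> sf sg k; apply: Ck_mul. Qed.

Lemma smoothN f : smooth f -> smooth (- f).
Proof.
move=> sf; rewrite (_ : - f = cst (-1) * f).
  by apply: smoothM => //; apply: smooth_cst.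
by apply/funext => x; rewrite /= /GRing.mul /= mulN1r.
Qed.

Lemma smooth_pderiv i f : smooth f -> smooth (pderiv i f).
Proof. by move=> sf k; case: (sf k.+1) => _ _; apply. Qed.

Lemma smoothCP F : reflect (smooth (reC F) /\ smooth (imC F)) (F \in smoothC).
Proof. exact: asboolP. Qed.

Fact smoothC_subring : subring_closed smoothC.
Proof.
split.
- by apply/smoothCP; split; exact: smooth_cst.
- move=> F G /smoothCP[rF iF] /smoothCP[rG iG]; apply/smoothCP; split.
  + rewrite (_ : reC _ = reC F + - reC G).
      by apply: smoothD => //; exact: smoothN.
    apply/funext=> x; rewrite -[RHS]/(reC F x - reC G x).
    by rewrite /reC -[(F - G) x]/(F x - G x); case: (F x) (G x) => [? ?] [? ?].
  + rewrite (_ : imC _ = imC F + - imC G).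
      by apply: smoothD => //; exact: smoothN.
    apply/funext=> x; rewrite -[RHS]/(imC F x - imC G x).
    by rewrite /imC -[(F - G) x]/(F x - G x); case: (F x) (G x) => [? ?] [? ?].
move=> F G /smoothCP[rF iF] /smoothCP[rG iG]; apply/smoothCP; split.
- rewrite (_ : reC _ = reC F * reC G + - (imC F * imC G)).
    by apply: smoothD; [exact: smoothM|apply: smoothN; exact: smoothM].
  apply/funext=> x; rewrite -[RHS]/(reC F x * reC G x - imC F x * imC G x).
  by rewrite /reC /imC -[(F * G) x]/(F x * G x); case: (F x) (G x) => [? ?] [? ?].
- rewrite (_ : imC _ = reC F * imC G + imC F * reC G).
    by apply: smoothD; exact: smoothM.
  apply/funext=> x; rewrite -[RHS]/(reC F x * imC G x + imC F x * reC G x).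
  by rewrite /reC /imC -[(F * G) x]/(F x * G x); case: (F x) (G x) => [? ?] [? ?].
Qed.

HB.instance Definition _ := GRing.isSubringClosed.Build (V -> R[i]) smoothC
  smoothC_subring.

(* The commutative ring (hence rig) of smooth functions R^n -> C, with
   pointwise operations. *)
Definition smoothfun := {F : V -> R[i] | F \in smoothC}.

HB.instance Definition _ := SubChoice.on smoothfun.
HB.instance Definition _ :=
  GRing.SubChoice_isSubComPzRing.Build (V -> R[i]) smoothC smoothfun
    smoothC_subring.

Fact sderiv_subproof i (F : smoothfun) :
  (fun x => (pderiv i (reC (sval F)) x +i* pderiv i (imC (sval F)) x)%C)
    \in smoothC.
Proof.
have /smoothCP[rF iF] := svalP F.
by apply/smoothCP; split; apply: smooth_pderiv.
Qed.

Fact sconst_subproof c : cst c \in smoothC.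
Proof. by apply/smoothCP; split; apply: smooth_cst. Qed.

Definition sderiv i (F : smoothfun) : smoothfun :=
  exist _ (fun x => (pderiv i (reC (sval F)) x +i* pderiv i (imC (sval F)) x)%C)
    (sderiv_subproof i F).

Definition sconst (c : R[i]) : smoothfun := exist _ (cst c) (sconst_subproof c).

End SmoothFunctions.

Section Phases.
Variables (R : realType) (n : nat).
Local Notation V := ('rV[R]_n).

Definition is_affine (f : V -> R) : Prop :=
  exists (l : {scalar V}) (b : R), forall x, f x = l x + b.

Record affine := Affine { affine_fun :> V -> R; affineP : is_affine affine_fun }.

Lemma linear_coord (l : {scalar V}) x :
  l x = \sum_j x 0 j * l (delta_mx 0 j).
Proof.
rewrite {1}(row_sum_delta x) linear_sum.
by apply: eq_bigr => j _; rewrite linearZ.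
Qed.

Lemma affine_continuous (f : affine) : continuous f.
Proof.
have [l [b fE]] := affineP f.
have cl : continuous (l : V -> R).
  rewrite (_ : (l : V -> R) = fun x => \sum_j x 0 j * l (delta_mx 0 j)).
    elim: (index_enum _) => [|j s IHs].
      rewrite (_ : (fun _ => _) = cst 0); first exact: cst_continuous.
      by apply/funext => x; rewrite big_nil.
    rewrite (_ : (fun _ => _) = (fun x : V => x 0 j * l (delta_mx 0 j))
                  + (fun x => \sum_(j <- s) x 0 j * l (delta_mx 0 j))).
      move=> x; apply: continuousD; last exact: IHs.
      apply: (continuousM (s := fun x : V => x 0 j)
                          (t := cst (l (delta_mx 0 j)))).
        exact: coord_continuous.
      exact: cst_continuous.
    by apply/funext => x; rewrite big_cons.
  by apply/funext => x; rewrite linear_coord.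
rewrite (_ : affine_fun f = (l : V -> R) + cst b); last exact/funext.
by move=> x; apply: continuousD; [exact: cl|exact: cst_continuous].
Qed.

Lemma is_derive1P (f : V -> R) (x v : V) (d : R) :
  is_derive (0 : R) (1 : R) (fun h : R => f (h *: v + x)) d -> is_derive x v f d.
Proof.
set g := fun h : R => _.
have E : (fun h : R => h^-1 *: ((g \o shift 0) (h *: 1) - g 0)) =
         (fun h : R => h^-1 *: ((f \o shift x) (h *: v) - f x)).
  by apply/funext => h; rewrite /g /= addr0 scale0r add0r [h%:A]mulr1.
by move=> [dg <-]; apply: DeriveDef; rewrite /derivable /derive -E.
Qed.

Lemma pderiv_cos_sin (f : affine) (c : R) (i : 'I_n) : exists a : R,
  (forall x, is_derive x (delta_mx 0 i) (fun x => cos (c * f x))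
                       (- a * sin (c * f x))) /\
  (forall x, is_derive x (delta_mx 0 i) (fun x => sin (c * f x))
                       (a * cos (c * f x))).
Proof.
have [l [b fE]] := affineP f; exists (c * l (delta_mx 0 i)).
have E x h : c * f (h *: delta_mx 0 i + x)
           = (c * l (delta_mx 0 i)) * h + c * f x.
  rewrite !fE linearD linearZ /=.
  by rewrite -addrA mulrDr; congr (_ + _); rewrite [h * _]mulrC mulrA.
have D x : is_derive (0 : R) (1 : R)
    (fun h : R => (c * l (delta_mx 0 i)) * h + c * f x) (c * l (delta_mx 0 i)).
  have H := is_deriveD (is_deriveZ (c * l (delta_mx 0 i))
              (is_derive_id (0 : R) (1 : R))) (is_derive_cst (c * f x) (0 : R) 1).
  have H1 := is_derive_eq H.
  by apply: H1; exact: (etrans (addr0 (_ * 1)) (mulr1 _)).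
have E0 x : c * f x = (c * l (delta_mx 0 i)) * 0 + c * f x.
  by rewrite mulr0 add0r.
split=> x; apply: is_derive1P; under eq_fun do rewrite E.
  have := is_derive1_comp (f := cos) (is_derive_cos _) (D x).
  by rewrite -E0 mulNr [sin _ * _]mulrC -mulNr.
have := is_derive1_comp (f := sin) (is_derive_sin _) (D x).
by rewrite -E0 [cos _ * _]mulrC.
Qed.

Lemma smooth_cos_sin (f : affine) (c : R) :
  smooth (fun x => cos (c * f x)) /\ smooth (fun x => sin (c * f x)).
Proof.
suff H k : Ck k (fun x => cos (c * f x)) /\ Ck k (fun x => sin (c * f x)).
  by split=> k; case: (H k).
have cf : continuous (fun x => c * f x).
  by move=> x; apply: (continuousM (s := cst c) (t := f));
    [exact: cst_continuous|exact: affine_continuous].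
have cc : continuous (fun x => cos (c * f x)).
  by move=> x; apply: continuous_comp; [exact: cf|exact: continuous_cos].
have cs : continuous (fun x => sin (c * f x)).
  by move=> x; apply: continuous_comp; [exact: cf|exact: continuous_sin].
elim: k => [|k [IHc IHs]] //=; split; split=> // i;
  have [a [Hc Hs]] := pderiv_cos_sin f c i.
- by move=> x; case: (Hc x).
- rewrite (_ : pderiv _ _ = cst (- a) * (fun x => sin (c * f x))).
    by apply: Ck_mul => //; exact: Ck_cst.
  by apply/funext => x; rewrite /pderiv derive_val.
- by move=> x; case: (Hs x).
- rewrite (_ : pderiv _ _ = cst a * (fun x => cos (c * f x))).
    by apply: Ck_mul => //; exact: Ck_cst.
  by apply/funext => x; rewrite /pderiv derive_val.
Qed.

Definition cexp (z : R[i]) : R[i] :=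
  let: (a +i* b)%C := z in (expR a)%:C%C * (cos b +i* sin b)%C.

Fact sexp_subproof (c : R) (f : affine) :
  (fun x => cexp ('i * (c * f x)%:C)%C) \in @smoothC R n.
Proof.
have [sc ss] := smooth_cos_sin f c.
have E t : cexp ('i * t%:C)%C = (cos t +i* sin t)%C.
  rewrite (_ : ('i * t%:C)%C = (0 +i* t)%C); last by simpc.
  by rewrite /cexp expR0 mul1r.
apply/smoothCP; split.
  rewrite (_ : reC _ = (fun x => cos (c * f x))) //.
  by apply/funext => x; rewrite /reC E.
rewrite (_ : imC _ = (fun x => sin (c * f x))) //.
by apply/funext => x; rewrite /imC E.
Qed.

(* x |-> e^(i c f(x)) *)
Definition sexp (c : R) (f : affine) : smoothfun R n :=
  exist _ (fun x => cexp ('i * (c * f x)%:C)%C) (sexp_subproof c f).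

End Phases.

Section Matrices.
Variable S : comPzRingType.

(* An arrow m -> n of Mat_S is a matrix of type 'M[S]_(n, m), so that a diagram
   x^a -> x^b is sent to a 2^b x 2^a matrix, ket-bra expressions keep their
   usual meaning and the diagrammatic composite f ; g is G *m F. The casts only
   identify 2 ^ (q + s) with 2 ^ q * 2 ^ s. *)
Definition kron p q r s (A : 'M[S]_(2 ^ q, 2 ^ p)) (B : 'M[S]_(2 ^ s, 2 ^ r)) :
    'M[S]_(2 ^ (q + s), 2 ^ (p + r)) :=
  castmx (esym (expnD 2 q s), esym (expnD 2 p r)) (A *t B).

(* The symmetry p (x) q -> q (x) p of Mat_S: e_j (x) e_k |-> e_k (x) e_j. *)
Definition swapmx p q : 'M[S]_(q * p, p * q) :=
  \matrix_(i, j)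
    (mxtens_unindex i == ((mxtens_unindex j).2, (mxtens_unindex j).1))%:R.

Definition swap2mx a b : 'M[S]_(2 ^ (b + a), 2 ^ (a + b)) :=
  castmx (esym (expnD 2 b a), esym (expnD 2 a b)) (swapmx (2 ^ a) (2 ^ b)).

Definition ket (x : 'I_2) : 'cV[S]_2 := delta_mx x 0.

(* |x>^(x)k: the library power has 1 ^ k columns. *)
Definition kets (x : 'I_2) (k : nat) : 'cV[S]_(2 ^ k) :=
  castmx (erefl, exp1n k) (ket x ^t k).

Definition bras (x : 'I_2) (k : nat) : 'rV[S]_(2 ^ k) := (kets x k)^T.

Lemma mulmx_castmx m n p m' n' p' (em : m = m') (en : n = n') (ep : p = p')
    (A : 'M[S]_(m, n)) (B : 'M[S]_(n, p)) :
  castmx (em, ep) (A *m B) = castmx (em, en) A *m castmx (en, ep) B.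
Proof. by case: m' / em; case: n' / en; case: p' / ep. Qed.

Lemma kron_mul a b c d e k (A : 'M[S]_(2 ^ b, 2 ^ a)) (A' : 'M[S]_(2 ^ c, 2 ^ b))
    (B : 'M[S]_(2 ^ e, 2 ^ d)) (B' : 'M[S]_(2 ^ k, 2 ^ e)) :
  kron (A' *m A) (B' *m B) = kron A' B' *m kron A B.
Proof. by rewrite /kron -mulmx_castmx tensmx_mul. Qed.

Definition hi q s (i : 'I_(2 ^ (q + s))) : 'I_(2 ^ q) :=
  (mxtens_unindex (cast_ord (expnD 2 q s) i)).1.
Definition lo q s (i : 'I_(2 ^ (q + s))) : 'I_(2 ^ s) :=
  (mxtens_unindex (cast_ord (expnD 2 q s) i)).2.

Lemma kronE p q r s (A : 'M[S]_(2 ^ q, 2 ^ p)) (B : 'M[S]_(2 ^ s, 2 ^ r)) i j :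
  kron A B i j = A (hi i) (hi j) * B (lo i) (lo j).
Proof. by rewrite /kron castmxE mxE !esymK. Qed.

Lemma eq_hilo q s (i j : 'I_(2 ^ (q + s))) :
  (i == j) = (hi i == hi j) && (lo i == lo j).
Proof.
rewrite -xpair_eqE /hi /lo -!surjective_pairing.
by rewrite (can_eq (@mxtens_unindexK _ _)) (inj_eq (@cast_ord_inj _ _ _)).
Qed.

Definition funmx m p (phi : 'I_m -> 'I_p) : 'M[S]_(p, m) :=
  \matrix_(i, j) (i == phi j)%:R.

Lemma funmx_mul m p q (phi : 'I_m -> 'I_p) (psi : 'I_p -> 'I_q) :
  funmx psi *m funmx phi = funmx (psi \o phi).
Proof.
apply/matrixP => i j; rewrite !mxE (bigD1 (phi j)) //= big1 => [|k kj].
  by rewrite addr0 !mxE eqxx mulr1.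
by rewrite !mxE (negPf kj) mulr0.
Qed.

Lemma funmx_mulr m p q (phi : 'I_m -> 'I_p) (A : 'M[S]_(q, p)) :
  A *m funmx phi = \matrix_(i, j) A i (phi j).
Proof.
apply/matrixP => i j; rewrite !mxE (bigD1 (phi j)) //= big1 => [|k kj].
  by rewrite addr0 !mxE eqxx mulr1.
by rewrite !mxE (negPf kj) mulr0.
Qed.

Lemma funmx1 m : 1%:M = funmx (@id 'I_m).
Proof. by apply/matrixP => i j; rewrite !mxE. Qed.

Lemma funmx_ext m p (phi psi : 'I_m -> 'I_p) : phi =1 psi -> funmx phi = funmx psi.
Proof. by move=> E; apply/matrixP => i j; rewrite !mxE E. Qed.

Definition hilo q s (i : 'I_(2 ^ q)) (j : 'I_(2 ^ s)) : 'I_(2 ^ (q + s)) :=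
  cast_ord (esym (expnD 2 q s)) (mxtens_index (i, j)).

Lemma hi_hilo q s i j : hi (@hilo q s i j) = i.
Proof. by rewrite /hi /hilo cast_ordKV mxtens_indexK. Qed.
Lemma lo_hilo q s i j : lo (@hilo q s i j) = j.
Proof. by rewrite /lo /hilo cast_ordKV mxtens_indexK. Qed.

Lemma kron_funmx a b c d (phi : 'I_(2 ^ a) -> 'I_(2 ^ b))
    (psi : 'I_(2 ^ c) -> 'I_(2 ^ d)) :
  kron (funmx phi) (funmx psi) =
  funmx (fun j : 'I_(2 ^ (a + c)) => hilo (phi (hi j)) (psi (lo j))).
Proof.
apply/matrixP => i j.
by rewrite kronE !mxE eq_hilo hi_hilo lo_hilo -mulnb natrM.
Qed.

Lemma swap2mxE a b : swap2mx a b = funmx (fun j => hilo (lo j) (hi j)).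
Proof.
apply/matrixP => i j; rewrite /swap2mx castmxE !mxE !esymK.
rewrite eq_hilo hi_hilo lo_hilo -xpair_eqE /hi /lo.
by rewrite -!surjective_pairing.
Qed.

Lemma castmx_funmx m p m' p' (em : m = m') (ep : p = p') (phi : 'I_m -> 'I_p) :
  castmx (ep, em) (funmx phi) =
  funmx (fun j => cast_ord ep (phi (cast_ord (esym em) j))).
Proof.
case: m' / em; case: p' / ep; rewrite castmx_id.
by apply: funmx_ext => j; rewrite !cast_ord_id.
Qed.

Lemma kron1 a b : kron (1%:M : 'M_(2 ^ a)) (1%:M : 'M_(2 ^ b)) = 1%:M.
Proof.
rewrite !funmx1 kron_funmx; apply: funmx_ext => j /=.
by apply/eqP; rewrite eq_hilo hi_hilo lo_hilo !eqxx.
Qed.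

Lemma kronA a b c d e k (A : 'M[S]_(2 ^ b, 2 ^ a)) (B : 'M[S]_(2 ^ d, 2 ^ c))
    (C : 'M[S]_(2 ^ k, 2 ^ e))
    (eb : (2 ^ (b + (d + k)) = 2 ^ (b + d + k))%N)
    (ea : (2 ^ (a + (c + e)) = 2 ^ (a + c + e))%N) :
  castmx (eb, ea) (kron A (kron B C)) = kron (kron A B) C.
Proof.
apply/matrixP => i j; rewrite castmxE !kronE mulrA.
have E x y z (e' : (2 ^ (x + (y + z)) = 2 ^ (x + y + z))%N)
    (l : 'I_(2 ^ (x + y + z))) :
  [/\ hi (cast_ord (esym e') l) = hi (hi l),
      hi (lo (cast_ord (esym e') l)) = lo (hi l) &
      lo (lo (cast_ord (esym e') l)) = lo l].
  split; apply: val_inj => /=; move: (nat_of_ord l) => u; rewrite !expnD.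
  - by rewrite mulnC divnMA.
  - by rewrite modn_divl.
  - by rewrite modn_dvdm // dvdn_mull.
by have [-> -> ->] := E _ _ _ eb i; have [-> -> ->] := E _ _ _ ea j.
Qed.

Lemma kron_id0l a b (A : 'M[S]_(2 ^ b, 2 ^ a)) eb ea :
  castmx (eb, ea) (kron (1%:M : 'M_(2 ^ 0)) A) = A.
Proof.
apply/matrixP => i j; rewrite castmxE kronE.
have hi0 x (l : 'I_(2 ^ (0 + x))) : hi l = ord0.
  by apply: ord_inj; case: (hi l) => -[].
rewrite mxE !hi0 eqxx mul1r; congr (A _ _); apply: val_inj => /=;
by rewrite modn_small.
Qed.

Lemma kron_id0r a b (A : 'M[S]_(2 ^ b, 2 ^ a)) eb ea :
  castmx (eb, ea) (kron A (1%:M : 'M_(2 ^ 0))) = A.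
Proof.
apply/matrixP => i j; rewrite castmxE kronE.
have lo0 x (l : 'I_(2 ^ (x + 0))) : lo l = ord0.
  by apply: ord_inj; case: (lo l) => -[].
rewrite mxE !lo0 eqxx mulr1; congr (A _ _); apply: val_inj => /=;
by rewrite divn1.
Qed.

Lemma swap2mxN a b c d (F : 'M[S]_(2 ^ b, 2 ^ a)) (G : 'M[S]_(2 ^ d, 2 ^ c)) :
  swap2mx b d *m kron F G = kron G F *m swap2mx a c.
Proof.
rewrite !swap2mxE funmx_mulr; apply/matrixP => i j.
rewrite !mxE (bigD1 (hilo (lo i) (hi i))) //= big1 => [|k ki].
  rewrite addr0 mxE !kronE !eq_hilo !hi_hilo !lo_hilo !eqxx mul1r.
  by rewrite mulrC.
rewrite mxE; case: (i =P _) ki => [->|_ _]; last by rewrite mul0r.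
by rewrite hi_hilo lo_hilo eq_hilo hi_hilo lo_hilo !eqxx.
Qed.

Lemma hiloK q s (i : 'I_(2 ^ (q + s))) : hilo (hi i) (lo i) = i.
Proof. by apply/eqP; rewrite eq_hilo hi_hilo lo_hilo !eqxx. Qed.

Lemma swap2mxK a b : swap2mx b a *m swap2mx a b = 1%:M.
Proof.
rewrite !swap2mxE funmx_mul funmx1; apply: funmx_ext => j /=.
by rewrite lo_hilo hi_hilo hiloK.
Qed.

Lemma cast_hiloA x y z (e : (2 ^ (x + y + z) = 2 ^ (x + (y + z)))%N) u v w :
  cast_ord e (hilo (@hilo x y u v) w) = hilo u (hilo v w).
Proof. by apply: val_inj => /=; rewrite expnD mulnA addnA mulnDl. Qed.

Lemma swap2mxD a b c e1 e2 e3 :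
  castmx (e1, e2) (swap2mx a (b + c)) =
  kron (1%:M : 'M_(2 ^ b)) (swap2mx a c) *m
  castmx (e3, erefl) (kron (swap2mx a b) (1%:M : 'M_(2 ^ c))).
Proof.
rewrite !swap2mxE !funmx1 !kron_funmx !castmx_funmx funmx_mul.
apply: funmx_ext => j /=; rewrite cast_ord_id.
rewrite -[j]hiloK -[hi j]hiloK; move: (hi (hi j)) (lo (hi j)) (lo j) => x y z.
by rewrite !(cast_hiloA, hi_hilo, lo_hilo).
Qed.

End Matrices.

Section Diagrams.
Variables (R : realType) (n : nat).

Inductive zxterm : nat -> nat -> Type :=
| Id a : zxterm a a
| Comp a b c : zxterm a b -> zxterm b c -> zxterm a c
| Tens a b c d : zxterm a b -> zxterm c d -> zxterm (a + c) (b + d)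
| Swap a b : zxterm (a + b) (b + a)
| Had : zxterm 1 1
| Spider k l (alpha : affine R n) : zxterm k l.

(* Strict associativity and unitality relate homsets whose objects are only
   propositionally equal; zxcast transports along these equalities. *)
Definition zxcast a b a' b' (ea : a = a') (eb : b = b') (f : zxterm a b) :
    zxterm a' b' :=
  ecast x (zxterm x b') ea (ecast y (zxterm a y) eb f).

Arguments zxcast : simpl never.

(* The congruence generated by the axioms of symmetric strict monoidal
   categories, and by nothing else *)
Inductive zxeq : forall a b, zxterm a b -> zxterm a b -> Prop :=
| zxeq_refl a b (f : zxterm a b) : zxeq f f
| zxeq_sym a b (f g : zxterm a b) : zxeq f g -> zxeq g f
| zxeq_trans a b (f g h : zxterm a b) : zxeq f g -> zxeq g h -> zxeq f h
| zxeq_Comp a b c (f f' : zxterm a b) (g g' : zxterm b c) :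
    zxeq f f' -> zxeq g g' -> zxeq (Comp f g) (Comp f' g')
| zxeq_Tens a b c d (f f' : zxterm a b) (g g' : zxterm c d) :
    zxeq f f' -> zxeq g g' -> zxeq (Tens f g) (Tens f' g')
| zxeq_CompA a b c d (f : zxterm a b) (g : zxterm b c) (h : zxterm c d) :
    zxeq (Comp f (Comp g h)) (Comp (Comp f g) h)
| zxeq_Comp1l a b (f : zxterm a b) : zxeq (Comp (Id a) f) f
| zxeq_Comp1r a b (f : zxterm a b) : zxeq (Comp f (Id b)) f
| zxeq_Tens1 a b : zxeq (Tens (Id a) (Id b)) (Id (a + b))
| zxeq_TensComp a b c d e k (f : zxterm a b) (g : zxterm b c)
    (h : zxterm d e) (j : zxterm e k) :
    zxeq (Tens (Comp f g) (Comp h j)) (Comp (Tens f h) (Tens g j))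
| zxeq_TensA a b c d e k (f : zxterm a b) (g : zxterm c d) (h : zxterm e k) :
    zxeq (zxcast (addnA a c e) (addnA b d k) (Tens f (Tens g h)))
         (Tens (Tens f g) h)
| zxeq_Tens0l a b (f : zxterm a b) :
    zxeq (zxcast (add0n a) (add0n b) (Tens (Id 0) f)) f
| zxeq_Tens0r a b (f : zxterm a b) :
    zxeq (zxcast (addn0 a) (addn0 b) (Tens f (Id 0))) f
| zxeq_SwapN a b c d (f : zxterm a b) (g : zxterm c d) :
    zxeq (Comp (Tens f g) (Swap b d)) (Comp (Swap a c) (Tens g f))
| zxeq_SwapK a b : zxeq (Comp (Swap a b) (Swap b a)) (Id (a + b))
| zxeq_SwapD a b c :
    zxeq (zxcast (addnA a b c) (esym (addnA b c a)) (Swap a (b + c)))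
         (Comp (zxcast (erefl _) (esym (addnA b a c)) (Tens (Swap a b) (Id c)))
               (Tens (Id b) (Swap a c))).

HB.instance Definition _ a b := gen_eqMixin (zxterm a b).
HB.instance Definition _ a b := gen_choiceMixin (zxterm a b).

Definition zxeqb a b : rel (zxterm a b) := fun f g => `[< zxeq f g >].

Fact zxeqb_refl a b : reflexive (@zxeqb a b).
Proof. by move=> f; apply/asboolP; exact: zxeq_refl. Qed.

Fact zxeqb_sym a b : symmetric (@zxeqb a b).
Proof. by move=> f g; apply/asboolP/asboolP; exact: zxeq_sym. Qed.

Fact zxeqb_trans a b : transitive (@zxeqb a b).
Proof.
by move=> g f h /asboolP fg /asboolP gh; apply/asboolP; exact: zxeq_trans fg gh.
Qed.

Canonical zxeqb_equiv a b :=
  EquivRel (@zxeqb a b) (@zxeqb_refl a b) (@zxeqb_sym a b) (@zxeqb_trans a b).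

(* The homset from x^a to x^b of the free symmetric strict monoidal category. *)
Definition zx a b := {eq_quot @zxeqb a b}%qT.

Local Open Scope quotient_scope.

Definition zxclass a b (f : zxterm a b) : zx a b := \pi f.

Lemma zxclassP a b (f g : zxterm a b) : zxclass f = zxclass g <-> zxeq f g.
Proof.
by split=> [/eqmodP /asboolP|fg] //; apply/eqmodP/asboolP.
Qed.

Definition zxid a : zx a a := zxclass (Id a).

Definition zxcomp a b c (f : zx a b) (g : zx b c) : zx a c :=
  zxclass (Comp (repr f) (repr g)).

Definition zxtens a b c d (f : zx a b) (g : zx c d) : zx (a + c) (b + d) :=
  zxclass (Tens (repr f) (repr g)).

Lemma zx_repr a b (f : zxterm a b) : zxeq (repr (zxclass f)) f.
Proof. by apply/zxclassP; rewrite /zxclass reprK. Qed.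

Lemma zxcompE a b c (f : zxterm a b) (g : zxterm b c) :
  zxcomp (zxclass f) (zxclass g) = zxclass (Comp f g).
Proof. by apply/zxclassP; apply: zxeq_Comp; exact: zx_repr. Qed.

Lemma zxtensE a b c d (f : zxterm a b) (g : zxterm c d) :
  zxtens (zxclass f) (zxclass g) = zxclass (Tens f g).
Proof. by apply/zxclassP; apply: zxeq_Tens; exact: zx_repr. Qed.

(* Formal sums: finite multisets of parallel diagrams; `+` adds
   multiplicities and mset0 is the empty sum. *)
Definition zxsum a b := {mset zx a b}%mset.
Identity Coercion zxsum_mset : zxsum >-> multiset_of.

Definition sid a : zxsum a a := [mset zxid a]%mset.

Definition scomp a b c (f : zxsum a b) (g : zxsum b c) : zxsum a c :=
  \big[msetD/mset0]_(x <- f) \big[msetD/mset0]_(y <- g) [mset zxcomp x y]%mset.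

Definition stens a b c d (f : zxsum a b) (g : zxsum c d) :
    zxsum (a + c) (b + d) :=
  \big[msetD/mset0]_(x <- f) \big[msetD/mset0]_(y <- g) [mset zxtens x y]%mset.

Record is_derivation (D : forall a b, zxsum a b -> zxsum a b) : Prop := {
  derivation0 : forall a b, D a b mset0 = mset0;
  derivationD : forall a b (f g : zxsum a b),
    D a b (f `+` g)%mset = (D a b f `+` D a b g)%mset;
  derivation_id : forall a, D a a (sid a) = mset0;
  derivation_comp : forall a b c (f : zxsum a b) (g : zxsum b c),
    D a c (scomp f g) = (scomp (D a b f) g `+` scomp f (D b c g))%mset;
  derivation_tens : forall a b c d (f : zxsum a b) (g : zxsum c d),
    D (a + c)%N (b + d)%N (stens f g)
    = (stens (D a b f) g `+` stens f (D c d g))%mset }.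

Local Notation S := (smoothfun R n).
Local Notation ket := (@ket S).
Local Notation kets := (@kets S).
Local Notation bras := (@bras S).

Definition hadmx : 'M[smoothfun R n]_2 :=
  sconst n ((Num.sqrt 2)^-1)%:C%C *:
    (ket 0 *m (ket 0)^T + ket 0 *m (ket 1)^T
     + ket 1 *m (ket 0)^T - ket 1 *m (ket 1)^T).

Definition spidermx (k l : nat) (alpha : affine R n) :
    'M[smoothfun R n]_(2 ^ l, 2 ^ k) :=
  sexp (- 2^-1) alpha *: (kets 0 l *m bras 0 k)
  + sexp 2^-1 alpha *: (kets 1 l *m bras 1 k).

Fixpoint interp_term a b (f : zxterm a b) : 'M[smoothfun R n]_(2 ^ b, 2 ^ a) :=
  match f in zxterm a b return 'M[smoothfun R n]_(2 ^ b, 2 ^ a) with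
  | Id a => 1%:M
  | Comp _ _ _ f g => interp_term g *m interp_term f
  | Tens _ _ _ _ f g => kron (interp_term f) (interp_term g)
  | Swap a b => swap2mx _ a b
  | Had => hadmx
  | Spider k l alpha => spidermx k l alpha
  end.

(* Independent of the representative: see interpE below. *)
Definition interp a b (f : zx a b) := interp_term (repr f).

Definition interp_sum a b (f : zxsum a b) : 'M[smoothfun R n]_(2 ^ b, 2 ^ a) :=
  \sum_(x <- f) interp x.

Lemma interp_cast a b a' b' (ea : a = a') (eb : b = b') (f : zxterm a b) :
  interp_term (zxcast ea eb f) =
  castmx (congr1 (expn 2) eb, congr1 (expn 2) ea) (interp_term f).
Proof. by case: a' / ea; case: b' / eb; rewrite castmx_id. Qed.

Lemma interp_termP a b (f g : zxterm a b) :
  zxeq f g -> interp_term f = interp_term g.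
Proof.
elim=> {a b f g} //=.
- by move=> a b f g h _ -> _ ->.
- by move=> a b c f f' g g' _ -> _ ->.
- by move=> a b c d f f' g g' _ -> _ ->.
- by move=> a b c d f g h; rewrite mulmxA.
- by move=> a b f; rewrite mulmx1.
- by move=> a b f; rewrite mul1mx.
- by move=> a b; rewrite kron1.
- by move=> *; rewrite kron_mul.
- by move=> a b c d e k f g h; rewrite interp_cast /= kronA.
- by move=> a b f; rewrite interp_cast /= kron_id0l.
- by move=> a b f; rewrite interp_cast /= kron_id0r.
- by move=> a b c d f g; rewrite swap2mxN.
- by move=> a b; rewrite swap2mxK.
by move=> a b c; rewrite !interp_cast /=; exact: swap2mxD.
Qed.

Lemma interpE a b (f : zxterm a b) : interp (zxclass f) = interp_term f.
Proof. by apply: interp_termP; exact: zx_repr. Qed.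

End Diagrams.

(* Main.v *)
Require Import Defs.
From HB Require Import structures.
From mathcomp Require Import all_boot all_order all_algebra.
From mathcomp Require Import finmap multiset complex mxtens.
From mathcomp Require Import all_classical reals topology normedtype derive.
From mathcomp Require Import trigo exp.

Set Implicit Arguments.
Unset Strict Implicit.
Unset Printing Implicit Defensive.

Import Order.TTheory GRing.Theory Num.Theory.
Import numFieldNormedType.Exports.

(** Differentiation of diagrams follows the product rule.  On a term built from
   the generators, the derivative is the list of all terms in which one spider
   has been replaced by its derivative, every other generator being constant:
   this is the recursion [dterm].

   The derivative of a spider exists as a formal sum because phases are affine.
   If [alpha / 2] has the constant partial derivative [a], differentiating
   [e^(-i alpha/2)] and [e^(i alpha/2)] multiplies them by [-i a] and [i a],
   which is [a] times the effect of replacing [alpha] by [alpha + pi]: hence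
   [d Z(alpha) = a Z(alpha + pi)].  The real number [a] has to be a diagram too.
   The spider [Z^(0,0)(b)] with constant phase denotes [2 cos (b / 2)], which
   takes all values in [-2, 2]; so a large enough number [N] of copies of
   one such spider adds up to [a] ([mul2n_cos_surj]).  The derivative of
   [Z(alpha)] is therefore [N] copies of [Z^(0,0)(b) (x) Z(alpha + pi)].

   The semantics [interp_dterm] follows by induction from the Leibniz rules for
   the matrix and Kronecker products.  For [dterm] to descend to diagrams, every
   axiom of symmetric strict monoidal categories must be preserved as an
   equality of multisets of diagrams ([dclassP]).  Both sides of each axiom use
   the same boxes, and replacing one box on both sides gives another instance of
   the axiom, so the two lists agree up to reordering; the reordering is
   nontrivial only for the interchange law and the naturality of swaps.  Finally
   [dsum] extends the derivative additively to formal sums, where the product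
   rules follow from the bilinearity of composition and tensor. *)

(** * Sums indexed by multisets *)

Section SumsOverMultisets.
Variable T : choiceType.
Local Open Scope mset_scope.

HB.instance Definition _ :=
  Monoid.isComLaw.Build {mset T} mset0 (@msetD T) (@msetDA T) (@msetDC T)
    (@mset0D T).

Lemma perm_enum_msetD (A B : {mset T}) :
  perm_eq (A `+` B) ((A : seq T) ++ (B : seq T)).
Proof.
by apply/allP => x _ /=; rewrite count_cat !count_mem_mset msetE2.
Qed.

Lemma seq_mset_cat (s t : seq T) : seq_mset (s ++ t) = seq_mset s `+` seq_mset t.
Proof. by apply/msetP => x; rewrite msetE2 !mset_seqE count_cat. Qed.

Variables (V : Type) (idx : V) (op : Monoid.com_law idx).

Lemma big_msetD (A B : {mset T}) (F : T -> V) :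
  \big[op/idx]_(x <- A `+` B) F x =
  op (\big[op/idx]_(x <- A) F x) (\big[op/idx]_(x <- B) F x).
Proof. by rewrite (perm_big _ (perm_enum_msetD A B)) big_cat. Qed.

Lemma big_mset1 (a : T) (F : T -> V) : \big[op/idx]_(x <- [mset a]) F x = F a.
Proof. by rewrite enum_msetn big_seq1. Qed.

Lemma big_mset_bind I (s : seq I) (G : I -> {mset T}) (F : T -> V) :
  \big[op/idx]_(x <- \big[msetD/mset0]_(j <- s) G j) F x =
  \big[op/idx]_(j <- s) \big[op/idx]_(x <- G j) F x.
Proof.
apply: (big_morph (fun A : {mset T} => \big[op/idx]_(x <- A) F x)).
  by move=> A B; exact: big_msetD.
exact: big_mset0.
Qed.

End SumsOverMultisets.

Lemma seq_mset_map (T U : choiceType) (h : T -> U) (s : seq T) :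
  seq_mset (map h s) = \big[msetD/mset0]_(x <- seq_mset s) [mset h x]%mset.
Proof.
rewrite (perm_big _ (perm_eq_seq_mset s)); elim: s => [|x s IHs] /=.
  by rewrite big_nil; apply/msetP => y; rewrite mset_seqE mset0E.
by rewrite mset_cons IHs big_cons.
Qed.

Local Open Scope mset_scope.

(** The product rule for a bilinear extension to multisets needs only be checked
   on pairs of elements: both sides become double sums over [s] and [t], the
   first term on the right after exchanging the sum over [t] with the sum over
   the derivative of [x]. *)
Lemma mset_Leibniz (A B C : choiceType) (h : A -> B -> C)
    (dA : A -> {mset A}) (dB : B -> {mset B}) (dC : C -> {mset C})
    (s : {mset A}) (t : {mset B}) :
  (forall x y, dC (h x y) = (\big[msetD/mset0]_(x' <- dA x) [mset h x' y])
                        `+` (\big[msetD/mset0]_(y' <- dB y) [mset h x y'])) ->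
  let sum2 (s : {mset A}) (t : {mset B}) :=
    \big[msetD/mset0]_(x <- s) \big[msetD/mset0]_(y <- t) [mset h x y] in
  \big[msetD/mset0]_(z <- sum2 s t) dC z =
  sum2 (\big[msetD/mset0]_(x <- s) dA x) t `+`
  sum2 s (\big[msetD/mset0]_(y <- t) dB y).
Proof.
move=> dh sum2; rewrite /sum2 !big_mset_bind -big_split; apply: eq_bigr => x _.
rewrite !big_mset_bind exchange_big -big_split; apply: eq_bigr => y _.
by rewrite big_mset1 dh.
Qed.

Local Close Scope mset_scope.

(** * The derivation on the ring of smooth functions *)

Section SmoothDerivative.
Variables (R : realType) (n : nat).
Local Notation V := ('rV[R]_n).
Local Notation S := (smoothfun R n).
Local Open Scope ring_scope.

(** Derivatives and smoothness are defined on real and imaginary parts, so every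
   identity between smooth functions is proved on these two parts. *)
Definition sre (F : S) : V -> R := reC (sval F).
Definition sim (F : S) : V -> R := imC (sval F).

Lemma smoothfunP (F G : S) : sre F = sre G -> sim F = sim G -> F = G.
Proof.
move=> eqre eqim; apply: val_inj; apply/funext => x /=.
move: (congr1 (@^~ x) eqre) (congr1 (@^~ x) eqim); rewrite /= /sre /sim /reC /imC.
by case: (sval F x) (sval G x) => [? ?] [? ?] /= -> ->.
Qed.

Lemma smooth_sre (F : S) : smooth (sre F).
Proof. by have /smoothCP[] := svalP F. Qed.

Lemma smooth_sim (F : S) : smooth (sim F).
Proof. by have /smoothCP[] := svalP F. Qed.

Lemma sreD (F G : S) : sre (F + G) = sre F + sre G.
Proof.
apply/funext => x; rewrite -[LHS]/(complex.Re (sval F x + sval G x)).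
by rewrite -[RHS]/(complex.Re (sval F x) + complex.Re (sval G x)) raddfD.
Qed.

Lemma simD (F G : S) : sim (F + G) = sim F + sim G.
Proof.
apply/funext => x; rewrite -[LHS]/(complex.Im (sval F x + sval G x)).
by rewrite -[RHS]/(complex.Im (sval F x) + complex.Im (sval G x)) raddfD.
Qed.

Lemma sreM (F G : S) : sre (F * G) = sre F * sre G - sim F * sim G.
Proof.
apply/funext => x; rewrite -[LHS]/(complex.Re (sval F x * sval G x)).
rewrite -[RHS]/(complex.Re (sval F x) * complex.Re (sval G x)
              - complex.Im (sval F x) * complex.Im (sval G x)).
by case: (sval F x) (sval G x) => [? ?] [? ?].
Qed.

Lemma simM (F G : S) : sim (F * G) = sre F * sim G + sim F * sre G.
Proof.
apply/funext => x; rewrite -[LHS]/(complex.Im (sval F x * sval G x)).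
rewrite -[RHS]/(complex.Re (sval F x) * complex.Im (sval G x)
              + complex.Im (sval F x) * complex.Re (sval G x)).
by case: (sval F x) (sval G x) => [? ?] [? ?].
Qed.

Variable i : 'I_n.
Local Notation d := (@sderiv R n i).

Lemma sre_sderiv F : sre (d F) = pderiv i (sre F). Proof. by []. Qed.
Lemma sim_sderiv F : sim (d F) = pderiv i (sim F). Proof. by []. Qed.

Lemma smooth_derivable (f : V -> R) x : smooth f -> derivable f x (delta_mx 0 i).
Proof. by move=> /(_ 1%N) [_ df _]; exact: df. Qed.

Lemma pderivD (f g : V -> R) : smooth f -> smooth g ->
  pderiv i (f + g) = pderiv i f + pderiv i g.
Proof.
by move=> sf sg; apply/funext => x; rewrite /pderiv deriveD //; exact: smooth_derivable.
Qed.

Lemma pderivB (f g : V -> R) : smooth f -> smooth g ->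
  pderiv i (f - g) = pderiv i f - pderiv i g.
Proof.
by move=> sf sg; apply/funext => x; rewrite /pderiv deriveB //; exact: smooth_derivable.
Qed.

Lemma pderivM (f g : V -> R) : smooth f -> smooth g ->
  pderiv i (f * g) = pderiv i f * g + f * pderiv i g.
Proof.
move=> sf sg; apply/funext => x.
rewrite /pderiv deriveM; [|exact: smooth_derivable..].
by rewrite addrC [_ *: _]mulrC.
Qed.

Lemma sderivD : {morph d : F G / F + G}.
Proof.
move=> F G; apply: smoothfunP.
  by rewrite sreD !sre_sderiv sreD pderivD //; exact: smooth_sre.
by rewrite simD !sim_sderiv simD pderivD //; exact: smooth_sim.
Qed.

Fact sderiv_nmod_morphism : nmod_morphism d.
Proof.
split; last exact: sderivD.
by apply: (addIr (d 0)); rewrite -sderivD !add0r.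
Qed.

HB.instance Definition _ := GRing.isNmodMorphism.Build S S d sderiv_nmod_morphism.

(** The product rule for complex-valued functions is that of the four real
   products in the real and imaginary parts, regrouped. *)
Lemma sderivM (F G : S) : d (F * G) = d F * G + F * d G.
Proof.
have [sF mF] := (smooth_sre F, smooth_sim F).
have [sG mG] := (smooth_sre G, smooth_sim G).
apply: smoothfunP.
  rewrite sreD !sreM !(sre_sderiv, sim_sderiv) sreM.
  rewrite pderivB; [|exact: smoothM..].
  by rewrite (pderivM sF sG) (pderivM mF mG) opprD; exact: addrACA.
rewrite simD !simM !(sre_sderiv, sim_sderiv) simM.
rewrite pderivD; [|exact: smoothM..].
by rewrite (pderivM sF mG) (pderivM mF sG); exact: addrACA.
Qed.

Lemma sderiv1 : d 1 = 0.
Proof. by apply: (addrI (d 1)); rewrite addr0 -{3}[1]mulr1 sderivM mulr1 mul1r. Qed.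

Lemma sderiv_sconst (c : R[i]) : d (sconst n c) = 0.
Proof. by apply: smoothfunP; apply/funext => x; exact: derive_cst. Qed.

Lemma sderiv_nat (m : nat) : d m%:R = 0.
Proof. by rewrite raddfMn /= sderiv1 mul0rn. Qed.

End SmoothDerivative.

(** * Entrywise differentiation of matrices *)

Section MatrixDerivative.
Variables (R : realType) (n : nat) (i : 'I_n).
Local Notation S := (smoothfun R n).
Local Notation "'d M" := (map_mx (sderiv i) M) (at level 10, M at level 8).
Local Open Scope ring_scope.

Lemma kronDl p q r s (A A' : 'M[S]_(2 ^ q, 2 ^ p)) (B : 'M[S]_(2 ^ s, 2 ^ r)) :
  kron (A + A') B = kron A B + kron A' B.
Proof. by apply/matrixP => k l; rewrite !(mxE, kronE) mulrDl. Qed.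

Lemma kronDr p q r s (A : 'M[S]_(2 ^ q, 2 ^ p)) (B B' : 'M[S]_(2 ^ s, 2 ^ r)) :
  kron A (B + B') = kron A B + kron A B'.
Proof. by apply/matrixP => k l; rewrite !(mxE, kronE) mulrDr. Qed.

Lemma kron0l p q r s (B : 'M[S]_(2 ^ s, 2 ^ r)) :
  kron (0 : 'M[S]_(2 ^ q, 2 ^ p)) B = 0.
Proof. by apply/matrixP => k l; rewrite !(mxE, kronE) mul0r. Qed.

Lemma kron0r p q r s (A : 'M[S]_(2 ^ q, 2 ^ p)) :
  kron A (0 : 'M[S]_(2 ^ s, 2 ^ r)) = 0.
Proof. by apply/matrixP => k l; rewrite !(mxE, kronE) mulr0. Qed.

Lemma kron_suml p q r s I (t : seq I) (F : I -> 'M[S]_(2 ^ q, 2 ^ p))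
    (B : 'M[S]_(2 ^ s, 2 ^ r)) :
  kron (\sum_(x <- t) F x) B = \sum_(x <- t) kron (F x) B.
Proof.
exact: (big_morph (fun A => kron A B) (fun A A' => kronDl A A' B) (kron0l _ _ B)).
Qed.

Lemma kron_sumr p q r s I (t : seq I) (A : 'M[S]_(2 ^ q, 2 ^ p))
    (F : I -> 'M[S]_(2 ^ s, 2 ^ r)) :
  kron A (\sum_(x <- t) F x) = \sum_(x <- t) kron A (F x).
Proof. exact: (big_morph (kron A) (kronDr A) (kron0r _ _ A)). Qed.

(** A scalar diagram tensored on the left acts by scalar multiplication, up to
   the definitional equality of [0 + b] and [b] in the dimensions. *)
Lemma kron_scalar0 a b (c : S) (A : 'M[S]_(2 ^ b, 2 ^ a)) :
  kron (c *: (1%:M : 'M_(2 ^ 0))) A = c *: A :> 'M_(2 ^ b, 2 ^ a).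
Proof.
rewrite -[in RHS](kron_id0l A erefl erefl) castmx_id.
suff E (k : 'I_(2 ^ (0 + b))) (l : 'I_(2 ^ (0 + a))) :
    kron (c *: (1%:M : 'M_(2 ^ 0))) A k l = c * kron (1%:M : 'M_(2 ^ 0)) A k l.
  by apply/matrixP => k l; rewrite [RHS]mxE; exact: E.
by rewrite !kronE mxE mulrA.
Qed.

Lemma map_sderiv_mul p q r (A : 'M[S]_(p, q)) (B : 'M[S]_(q, r)) :
  'd (A *m B) = 'd A *m B + A *m 'd B.
Proof.
apply/matrixP => k l; rewrite !mxE raddf_sum -big_split; apply: eq_bigr => j _.
by rewrite /= sderivM !mxE.
Qed.

Lemma map_sderiv_kron p q r s (A : 'M[S]_(2 ^ q, 2 ^ p)) (B : 'M[S]_(2 ^ s, 2 ^ r)) :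
  'd (kron A B) = kron ('d A) B + kron A ('d B).
Proof. by apply/matrixP => k l; rewrite !(mxE, kronE) sderivM. Qed.

Lemma map_sderiv_tens p q r s (A : 'M[S]_(p, q)) (B : 'M[S]_(r, s)) :
  'd (A *t B) = 'd A *t B + A *t 'd B.
Proof. by apply/matrixP => k l; rewrite !mxE sderivM. Qed.

Lemma map_sderiv1 p : 'd (1%:M : 'M[S]_p) = 0.
Proof. by apply/matrixP => k l; rewrite !mxE sderiv_nat. Qed.

Lemma map_sderiv_swap a b : 'd (swap2mx S a b) = 0.
Proof. by apply/matrixP => k l; rewrite swap2mxE !mxE sderiv_nat. Qed.

Lemma map_sderivZ_const p q (c : S) (A : 'M[S]_(p, q)) :
  'd A = 0 -> 'd (c *: A) = sderiv i c *: A.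
Proof.
move=> /matrixP A0; apply/matrixP => k l.
by have := A0 k l; rewrite !mxE sderivM => ->; rewrite mulr0 addr0.
Qed.

Lemma map_sderiv_tr p q (A : 'M[S]_(p, q)) : 'd A = 0 -> 'd A^T = 0.
Proof. by move=> A0; rewrite -map_trmx A0 trmx0. Qed.

Lemma map_sderiv_mul0 p q r (A : 'M[S]_(p, q)) (B : 'M[S]_(q, r)) :
  'd A = 0 -> 'd B = 0 -> 'd (A *m B) = 0.
Proof. by move=> A0 B0; rewrite map_sderiv_mul A0 B0 mul0mx mulmx0 addr0. Qed.

Lemma map_sderiv_ket x : 'd (ket S x) = 0.
Proof. by apply/matrixP => k l; rewrite !mxE sderiv_nat. Qed.

Lemma map_sderiv_kets x k : 'd (kets S x k) = 0.
Proof.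
rewrite /kets map_castmx; suff -> : 'd (ket S x ^t k) = 0.
  by apply/matrixP => p q; rewrite castmxE !mxE.
(* The tensor power is the identity at 0 and the matrix itself at 1. *)
case: k => [|k]; first exact: map_sderiv1.
elim: k => [|k IHk]; first exact: map_sderiv_ket.
by rewrite ntensmxSS map_sderiv_tens map_sderiv_ket IHk tens0mx tensmx0 addr0.
Qed.

Lemma map_sderiv_ketbra x k l : 'd (kets S x l *m bras S x k) = 0.
Proof.
apply: map_sderiv_mul0; first exact: map_sderiv_kets.
by apply: map_sderiv_tr; exact: map_sderiv_kets.
Qed.

Lemma map_sderiv_had : 'd (hadmx R n) = 0.
Proof.
rewrite /hadmx map_sderivZ_const ?sderiv_sconst ?scale0r //.
have d0D (A B C D : 'M[S]_2) :
    'd A = 0 -> 'd B = 0 -> 'd C = 0 -> 'd D = 0 -> 'd (A + B + C - D) = 0.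
  by move=> dA dB dC dD; rewrite map_mxB !map_mxD dA dB dC dD !addr0 subr0.
by apply: d0D; apply: map_sderiv_mul0; rewrite ?map_sderiv_tr ?map_sderiv_ket.
Qed.

End MatrixDerivative.

(** * Differentiation of spiders *)

Section PhaseShift.
Variables (R : realType) (n : nat).
Local Notation S := (smoothfun R n).
Local Open Scope ring_scope.

Fact shift_phase_subproof (alpha : affine R n) (t : R) :
  is_affine (fun x => alpha x + t).
Proof.
by have [l [b E]] := affineP alpha; exists l, (b + t) => x; rewrite E addrA.
Qed.

Definition shift_phase alpha t := Affine (shift_phase_subproof alpha t).

Fact const_phase_subproof (t : R) : is_affine (fun _ : 'rV[R]_n => t).
Proof. by exists \0, t => x; rewrite add0r. Qed.

Definition const_phase t := Affine (const_phase_subproof t).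

Lemma sexpE (c : R) (alpha : affine R n) :
  sval (sexp c alpha) = (fun x => (cos (c * alpha x) +i* sin (c * alpha x))%C).
Proof.
apply/funext => x; rewrite -[LHS]/(cexp ('i * (c * alpha x)%:C)%C).
rewrite (_ : ('i * _)%C = (0 +i* (c * alpha x))%C); last by simpc.
by rewrite /cexp expR0 mul1r.
Qed.

Lemma sre_sexp (c : R) (alpha : affine R n) :
  sre (sexp c alpha) = fun x => cos (c * alpha x).
Proof. by apply/funext => x; rewrite /sre /reC sexpE. Qed.

Lemma sim_sexp (c : R) (alpha : affine R n) :
  sim (sexp c alpha) = fun x => sin (c * alpha x).
Proof. by apply/funext => x; rewrite /sim /imC sexpE. Qed.

Lemma sre_scaler (a : R) (F : S) : sre (sconst n a%:C%C * F) = fun x => a * sre F x.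
Proof. by apply/funext => x; rewrite sreM /= -[LHS]/(a * _ - 0 * _) mul0r subr0. Qed.

Lemma sim_scaler (a : R) (F : S) : sim (sconst n a%:C%C * F) = fun x => a * sim F x.
Proof. by apply/funext => x; rewrite simM /= -[LHS]/(a * _ + 0 * _) mul0r addr0. Qed.

(** Shifting a phase by [pi] shifts its half by [pi / 2], and a quarter turn
   of the argument is what differentiation does to [cos] and [sin]. *)
Lemma half_turn (u : R) : 2^-1 * (u + pi) = 2^-1 * u + pi / 2.
Proof. by rewrite mulrDr [pi / 2]mulrC. Qed.

(** The slope [a] is that of [alpha / 2].  The same [a] serves both exponents: the
   signs from differentiating [e^(-i alpha/2)] and from its shift cancel, which
   is why shifting the phase of a spider differentiates both of its terms. *)
Lemma sderiv_sexp_half (i : 'I_n) (alpha : affine R n) : exists a : R,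
  forall c, c \in [:: 2^-1; - 2^-1] ->
    sderiv i (sexp c alpha) = sconst n a%:C%C * sexp c (shift_phase alpha pi).
Proof.
have [a [dcos dsin]] := pderiv_cos_sin alpha 2^-1 i; exists a => c.
rewrite !inE => /orP[]/eqP ->; apply: smoothfunP.
- rewrite sre_sderiv sre_scaler !sre_sexp; apply/funext => x.
  by rewrite /pderiv derive_val half_turn cosDpihalf mulNr mulrN.
- rewrite sim_sderiv sim_scaler !sim_sexp; apply/funext => x.
  by rewrite /pderiv derive_val half_turn sinDpihalf.
- rewrite sre_sderiv sre_scaler !sre_sexp; apply/funext => x.
  under eq_fun do rewrite mulNr cosN.
  by rewrite /pderiv derive_val (mulNr 2^-1) cosN half_turn cosDpihalf mulNr mulrN.
rewrite sim_sderiv sim_scaler !sim_sexp; apply/funext => x.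
rewrite (_ : (fun _ => _) = - (fun x => sin (2^-1 * alpha x))); last first.
  by apply/funext => y; rewrite mulNr sinN.
by rewrite /pderiv deriveN // derive_val (mulNr 2^-1) sinN half_turn sinDpihalf mulrN.
Qed.

(** Every real number is a natural multiple of some [2 cos (b / 2)], the scalar
   denoted by a spider without legs. *)
Lemma mul2n_cos_surj (a : R) : exists (N : nat) (b : R),
  (2 * cos (2^-1 * b)) *+ N = a.
Proof.
set N := (Num.trunc `|a|).+1; exists N.
have N0 : (0 : R) < 2 * N%:R by rewrite mulr_gt0.
have aN : `|a| <= 2 * N%:R.
  rewrite (le_trans (ltW (truncnS_gt _))) // -/N ler_peMl //; exact: ler1n.
(* N exceeds |a|, so a / 2N lies in [-1, 1] and b is twice its arc cosine. *)
exists (2 * acos (a / (2 * N%:R))); rewrite mulKf ?pnatr_eq0 // acosK; last first.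
  by rewrite in_itv /= -ler_norml normrM normfV (gtr0_norm N0) ler_pdivrMr ?mul1r.
by rewrite -mulr_natr mulrAC [2 * N%:R * _]mulrC divfK ?gt_eqF.
Qed.

Lemma sconst_mulrn (a : R) N : sconst n a%:C%C *+ N = sconst n (a *+ N)%:C%C.
Proof.
elim: N => [|N IHN]; first exact: smoothfunP.
rewrite mulrS IHN; apply: smoothfunP; first by rewrite sreD mulrS.
by rewrite simD; apply/funext => x; exact: addr0.
Qed.

Lemma spidermx00 (t : R) :
  spidermx 0 0 (const_phase t) = sconst n (2 * cos (2^-1 * t))%:C%C *: 1%:M.
Proof.
have kb x : kets S x 0 *m bras S x 0 = 1%:M.
  rewrite /bras (_ : kets S x 0 = 1%:M); last first.
    by rewrite /kets (eq_irrelevance (exp1n 0) erefl) castmx_id; exact: ntensmx0.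
  by rewrite mul1mx trmx1.
rewrite /spidermx !kb -scalerDl; congr (_ *: _); apply: smoothfunP.
  rewrite sreD !sre_sexp; apply/funext => x.
  by rewrite -[LHS]/(cos _ + cos _) mulNr cosN
    -[RHS]/(2 * cos (2^-1 * t)) mulr_natl mulr2n.
rewrite simD !sim_sexp; apply/funext => x.
by rewrite -[LHS]/(sin _ + sin _) mulNr sinN addNr.
Qed.

(** The kets and bras are constant, so only the two exponentials contribute. *)
Lemma sderiv_spidermx (i : 'I_n) k l (alpha : affine R n) (a : R) :
  (forall c, c \in [:: 2^-1; - 2^-1] ->
    sderiv i (sexp c alpha) = sconst n a%:C%C * sexp c (shift_phase alpha pi)) ->
  map_mx (sderiv i) (spidermx k l alpha) =
  sconst n a%:C%C *: spidermx k l (shift_phase alpha pi).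
Proof.
move=> da; rewrite /spidermx map_mxD !map_sderivZ_const ?map_sderiv_ketbra //.
by rewrite !da ?inE ?eqxx ?orbT // scalerDr !scalerA.
Qed.

End PhaseShift.

(** * Differentiation of diagrams *)

Section DiagrammaticDerivative.
Variables (R : realType) (n : nat) (i : 'I_n).
Local Notation T := (zxterm R n).
Local Notation "'d M" := (map_mx (sderiv i) M) (at level 10, M at level 8).

Lemma spider_scalar_exists (alpha : affine R n) : exists p : nat * R,
  forall c, c \in [:: 2^-1; - 2^-1]%R ->
    sderiv i (sexp c alpha) =
    (sconst n ((2 * cos (2^-1 * p.2)) *+ p.1)%:C%C * sexp c (shift_phase alpha pi))%R.
Proof.
have [a da] := sderiv_sexp_half i alpha; have [N [b Nb]] := mul2n_cos_surj a.
by exists (N, b) => c /da; rewrite Nb.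
Qed.

(** The number of copies and the phase of the spider without legs whose sum is
   half the slope of [alpha]. *)
Definition spider_scalar alpha := sval (cid (spider_scalar_exists alpha)).

Definition dspider k l (alpha : affine R n) : seq (T k l) :=
  let: (N, b) := spider_scalar alpha in
  nseq N (Tens (Spider 0 0 (const_phase n b)) (Spider k l (shift_phase alpha pi))).

Fixpoint dterm a b (f : T a b) : seq (T a b) :=
  match f in zxterm _ _ a b return seq (T a b) with
  | Id a => [::]
  | Comp _ _ _ f g =>
      [seq Comp f' g | f' <- dterm f] ++ [seq Comp f g' | g' <- dterm g]
  | Tens _ _ _ _ f g =>
      [seq Tens f' g | f' <- dterm f] ++ [seq Tens f g' | g' <- dterm g]
  | Swap a b => [::]
  | Had => [::]
  | Spider k l alpha => dspider k l alpha
  end.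

Lemma interp_dspider k l (alpha : affine R n) :
  (\sum_(g <- dspider k l alpha) interp_term g)%R = 'd (spidermx k l alpha).
Proof.
rewrite /dspider /spider_scalar; case: cid => -[N b] /= da.
rewrite (sderiv_spidermx k l da) big_nseq iter_addr addr0 /=.
by rewrite spidermx00 kron_scalar0 scalerMnl sconst_mulrn.
Qed.

Lemma interp_dterm a b (f : T a b) :
  (\sum_(g <- dterm f) interp_term g)%R = 'd (interp_term f).
Proof.
elim: f => {a b} /=.
- by move=> a; rewrite big_nil map_sderiv1.
- move=> a b c f IHf g IHg; rewrite big_cat !big_map /= map_sderiv_mul -IHf -IHg.
  by rewrite mulmx_sumr mulmx_suml addrC.
- move=> a b c e f IHf g IHg; rewrite big_cat !big_map /= map_sderiv_kron -IHf -IHg.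
  by rewrite kron_suml kron_sumr.
- by move=> a b; rewrite big_nil map_sderiv_swap.
- by rewrite big_nil map_sderiv_had.
- exact: interp_dspider.
Qed.

Definition dclass a b (f : T a b) : seq (zx R n a b) := map (@zxclass R n a b) (dterm f).

Lemma dclass_Comp a b c (f : T a b) (g : T b c) :
  dclass (Comp f g) = [seq zxcomp x (zxclass g) | x <- dclass f]
                   ++ [seq zxcomp (zxclass f) y | y <- dclass g].
Proof.
rewrite /dclass /= map_cat -!map_comp; congr (_ ++ _);
by apply: eq_map => h /=; rewrite zxcompE.
Qed.

Lemma dclass_Tens a b c e (f : T a b) (g : T c e) :
  dclass (Tens f g) = [seq zxtens x (zxclass g) | x <- dclass f]
                   ++ [seq zxtens (zxclass f) y | y <- dclass g].
Proof.
rewrite /dclass /= map_cat -!map_comp; congr (_ ++ _);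
by apply: eq_map => h /=; rewrite zxtensE.
Qed.

Lemma dterm_cast a b a' b' (ea : a = a') (eb : b = b') (f : T a b) :
  dterm (zxcast ea eb f) = map (zxcast ea eb) (dterm f).
Proof. by case: a' / ea; case: b' / eb; rewrite map_id. Qed.

Lemma eq_perm (U : eqType) (s t : seq U) : s = t -> perm_eq s t.
Proof. by move=> ->. Qed.

(** Each side of an axiom contains the same boxes, and differentiating one of them
   on both sides yields an instance of the same axiom, so the lists match term by
   term up to reordering.  In the axioms between boxless diagrams both lists are empty. *)
Lemma dclassP a b (f g : T a b) : zxeq f g -> perm_eq (dclass f) (dclass g).
Proof.
elim=> {a b f g}.
- by [].
- by move=> a b f g _; rewrite perm_sym.
- by move=> a b f g h _ fg _; exact: perm_trans.
- move=> a b c f f' g g' /zxclassP ff' Hf /zxclassP gg' Hg.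
  by rewrite !dclass_Comp ff' gg'; apply: perm_cat; exact: perm_map.
- move=> a b c e f f' g g' /zxclassP ff' Hf /zxclassP gg' Hg.
  by rewrite !dclass_Tens ff' gg'; apply: perm_cat; exact: perm_map.
- move=> a b c e f g h; apply: eq_perm.
  rewrite /dclass /= !map_cat -!map_comp -!catA.
  by congr (_ ++ (_ ++ _)); apply: eq_map => x /=; apply/zxclassP; exact: zxeq_CompA.
- move=> a b f; apply: eq_perm; rewrite /dclass /= -map_comp.
  by apply: eq_map => x /=; apply/zxclassP; exact: zxeq_Comp1l.
- move=> a b f; apply: eq_perm; rewrite /dclass /= cats0 -map_comp.
  by apply: eq_map => x /=; apply/zxclassP; exact: zxeq_Comp1r.
- by [].
(* Interchange lists the factors as f, g, h, j on the left and as f, h, g, j on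
   the right. *)
- move=> a b c e k l f g h j; rewrite /dclass /= !map_cat -!map_comp perm_catACA.
  apply: eq_perm; congr ((_ ++ _) ++ (_ ++ _));
  by apply: eq_map => x /=; apply/zxclassP; exact: zxeq_TensComp.
- move=> a b c e k l f g h; apply: eq_perm.
  rewrite /dclass dterm_cast /= !map_cat -!map_comp -!catA.
  by congr (_ ++ (_ ++ _)); apply: eq_map => x /=; apply/zxclassP; exact: zxeq_TensA.
- move=> a b f; apply: eq_perm; rewrite /dclass dterm_cast /= -!map_comp.
  by apply: eq_map => x /=; apply/zxclassP; exact: zxeq_Tens0l.
- move=> a b f; apply: eq_perm; rewrite /dclass dterm_cast /= cats0 -!map_comp.
  by apply: eq_map => x /=; apply/zxclassP; exact: zxeq_Tens0r.
(* Naturality of the swap exchanges the order of f and g. *)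
- move=> a b c e f g; rewrite /dclass /= cats0 !map_cat -!map_comp perm_catC.
  apply: eq_perm; congr (_ ++ _);
  by apply: eq_map => x /=; apply/zxclassP; exact: zxeq_SwapN.
- by [].
by move=> a b c; rewrite dclass_Comp /dclass !dterm_cast.
Qed.

Definition dzx a b (x : zx R n a b) : zxsum R n a b := seq_mset (dclass (repr x)).

Lemma dzxE a b (f : T a b) : dzx (zxclass f) = seq_mset (dclass f).
Proof. by apply/eq_seq_msetP; apply: dclassP; exact: zx_repr. Qed.

Lemma zxclass_repr a b (x : zx R n a b) : zxclass (repr x) = x.
Proof. exact: reprK. Qed.

Local Open Scope mset_scope.

Lemma dzx_comp a b c (x : zx R n a b) (y : zx R n b c) :
  dzx (zxcomp x y) = (\big[msetD/mset0]_(x' <- dzx x) [mset zxcomp x' y])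
                 `+` (\big[msetD/mset0]_(y' <- dzx y) [mset zxcomp x y']).
Proof.
rewrite {1}/zxcomp dzxE dclass_Comp seq_mset_cat !(seq_mset_map _ (dclass _)).
by rewrite !zxclass_repr.
Qed.

Lemma dzx_tens a b c e (x : zx R n a b) (y : zx R n c e) :
  dzx (zxtens x y) = (\big[msetD/mset0]_(x' <- dzx x) [mset zxtens x' y])
                 `+` (\big[msetD/mset0]_(y' <- dzx y) [mset zxtens x y']).
Proof.
rewrite {1}/zxtens dzxE dclass_Tens seq_mset_cat !(seq_mset_map _ (dclass _)).
by rewrite !zxclass_repr.
Qed.

Definition dsum a b (s : zxsum R n a b) : zxsum R n a b :=
  \big[msetD/mset0]_(x <- s) dzx x.

Lemma dsum_is_derivation : is_derivation dsum.
Proof.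
split.
- by move=> a b; rewrite /dsum big_mset0.
- by move=> a b f g; rewrite /dsum big_msetD.
- move=> a; rewrite /dsum /sid big_mset1 dzxE.
  by apply/msetP => x; rewrite mset_seqE mset0E.
- by move=> a b c f g; apply: mset_Leibniz => x y; exact: dzx_comp.
- by move=> a b c e f g; apply: mset_Leibniz => x y; exact: dzx_tens.
Qed.

Lemma interp_dzx a b (x : zx R n a b) : interp_sum (dzx x) = 'd (interp x).
Proof.
rewrite /interp_sum (perm_big _ (perm_eq_seq_mset _)) big_map [in RHS]/interp -interp_dterm.
by apply: eq_bigr => g _; rewrite interpE.
Qed.

Lemma interp_dsum a b (s : zxsum R n a b) : interp_sum (dsum s) = 'd (interp_sum s).
Proof.
rewrite {1}/interp_sum big_mset_bind /interp_sum.
rewrite (big_morph _ (fun A B => map_mxD (sderiv i) A B) (map_mx0 (sderiv i) _ _)).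
by apply: eq_bigr => x _; exact: interp_dzx.
Qed.

End DiagrammaticDerivative.

Theorem theorem2p3p9 (R : realType) (n : nat) (i : 'I_n) :
  exists D : forall a b : nat, zxsum R n a b -> zxsum R n a b,
    is_derivation D /\
    forall (a b : nat) (d : zxsum R n a b),
      interp_sum (D a b d) = map_mx (sderiv i) (interp_sum d).
Proof.
exists (dsum i); split; first exact: dsum_is_derivation.
by move=> a b d; exact: interp_dsum.
Qed.
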